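(* Let $k\geq 2$ be an integer and let $\ell$ be the least common multiple of all positive even integers $\leq 2k$. Then for all integers $n\geq 1$, \[\overline{pl}_{2k+1}(\ell n+2^j)\equiv \overline{p}(\ell n+2^j)\pmod 4\] for every integer $j\geq 2$ with $j\equiv 0\pmod 2$ and $2^{j-1}\leq k$. Moreover, if $k\equiv 0\pmod 2$, then for all integers $n\geq 0$, \[\overline{pl}_{2k+1}(\ell n)\equiv \overline{p}(\ell n)\pmod 4.\]
   Context: A plane overpartition of $n$ is a plane partition of $n$ (an array $(\pi_{ij})_{i,j\geq1}$ of nonnegative integers, weakly decreasing along rows and down columns, with $\sum\pi_{ij}=n$) in which entries may be overlined subject to: in each row, the last occurrence of an integer may be overlined or not and all other occurrences of that integer in the row are not overlined; in each column, the first occurrence of an integer may be overlined or not and all other occurrences of that integer in the column are overlined. A $k$-rowed plane overpartition is a plane overpartition with at most $k$ (nonzero) rows; $\overline{pl}_k(n)$ is their number ($\overline{pl}_k(0)=1$), with generating function $\sum_{n\geq0}\overline{pl}_k(n)q^n=\prod_{n\geq1}\left(\frac{1+q^n}{1-q^n}\right)^{\min\{k,n\}}$. An overpartition of $n$ is a partition of $n$ in which the first occurrence of each part may be overlined; $\overline{p}(n)$ is the number of overpartitions of $n$ ($\overline{p}(0)=1$), with generating function $\prod_{n\geq1}\frac{1+q^n}{1-q^n}$. *)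

(* Defs.v *)
From mathcomp Require Import all_boot finmap.
From mathcomp Require Import boolp classical_sets functions cardinality.

Set Implicit Arguments.
Unset Strict Implicit.
Unset Printing Implicit Defensive.

Local Open Scope classical_set_scope.

(* Infinite arrays, 0-indexed (row first): the entry of [a] at (i, j) has value
   [(a i j).1] and is overlined when [(a i j).2]. *)
Definition overarray := nat -> nat -> nat * bool.

Definition plane_partition (n : nat) (p : nat -> nat -> nat) : Prop :=
  [/\ forall i j, p i j.+1 <= p i j,
      forall i j, p i.+1 j <= p i j
    & exists N, (forall i j, N <= i \/ N <= j -> p i j = 0) /\
                \sum_(i < N) \sum_(j < N) p i j = n].

(* The zeros of the array are not parts: they are never overlined, and the
   conditions on rows and columns only concern positive entries. *)
Definition plane_overpartition (n : nat) (a : overarray) : Prop :=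
  [/\ plane_partition n (fun i j => (a i j).1),
      forall i j, (a i j).1 = 0 -> (a i j).2 = false,
      forall i j j', 0 < (a i j).1 -> j < j' -> (a i j').1 = (a i j).1 ->
        (a i j).2 = false
    & forall i i' j, 0 < (a i j).1 -> i' < i -> (a i' j).1 = (a i j).1 ->
        (a i j).2 = true].

(* Columns being weakly decreasing, the nonzero rows come first. *)
Definition rowed_plane_overpartition (k n : nat) (a : overarray) : Prop :=
  plane_overpartition n a /\ forall i j, k <= i -> (a i j).1 = 0.

(* [fset_set] sends infinite sets to the empty set; the two sets counted below
   are finite by [finite_rowed_plane_overpartition] and [finite_overpartition]. *)
Definition pl_bar (k n : nat) : nat :=
  #|` fset_set [set a | rowed_plane_overpartition k n a] |.

(* The list of the parts, each with its overlining bit. *)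
Definition overpartition (n : nat) (s : seq (nat * bool)) : Prop :=
  [/\ sorted geq (unzip1 s), all (fun x => 0 < x) (unzip1 s),
      sumn (unzip1 s) = n
    & forall i i', i' < i < size s ->
        nth 0 (unzip1 s) i' = nth 0 (unzip1 s) i ->
        nth false (unzip2 s) i = false].

Definition p_bar (n : nat) : nat := #|` fset_set [set s | overpartition n s] |.

Definition lcm_evens (k : nat) : nat :=
  \big[lcmn/1]_(1 <= m < (2 * k).+1 | 2 %| m) m.

Lemma plane_partition_box n p : plane_partition n p ->
  (forall i j, p i j <= n) /\ (forall i j, n <= i \/ n <= j -> p i j = 0).
Proof.
case=> prow pcol [N [pN sumN]].
have homrow i j j' : j <= j' -> p i j' <= p i j.
  elim: j' => [|j' IH]; first by rewrite leqn0 => /eqP->.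
  rewrite leq_eqVlt => /orP[/eqP->//|/IH]; exact: leq_trans (prow _ _).
have homcol i i' j : i <= i' -> p i' j <= p i j.
  elim: i' => [|i' IH]; first by rewrite leqn0 => /eqP->.
  rewrite leq_eqVlt => /orP[/eqP->//|/IH]; exact: leq_trans (pcol _ _).
have lt_N i j : 0 < p i j -> i < N /\ j < N.
  by move=> p0; split; rewrite ltnNge; apply/negP => h;
    move: p0; rewrite pN //; [left | right].
have lesum (q : nat -> nat) m : m <= N ->
    \sum_(t < m) q t <= \sum_(t < N) q t.
  move=> mN; rewrite -!(big_mkord xpredT) (@big_cat_nat _ _ _ m 0 N) //=.
  exact: leq_addr.
have leT (q : nat -> nat) i : i < N -> q i <= \sum_(t < N) q t.
  by move=> iN; rewrite (bigD1 (Ordinal iN)) //= leq_addr.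
have le1 m (q : nat -> nat) : (forall t, t < m -> 0 < q t) ->
    m <= \sum_(t < m) q t.
  move=> q0; rewrite -[leqLHS]card_ord -sum1_card; apply: leq_sum => t _.
  exact: q0.
have len i j : p i j <= n.
  case: (posnP (p i j)) => [->//|p0]; have [iN jN] := lt_N _ _ p0.
  rewrite -sumN; apply: leq_trans (leT (p i) _ jN) _.
  exact: (leT (fun i => \sum_(j < N) p i j)).
split=> // i j h; apply/eqP; rewrite -leqn0 leqNgt; apply/negP => p0.
have [iN jN] := lt_N _ _ p0.
suff: i < n /\ j < n by case=> i_lt j_lt; case: h; rewrite leqNgt ?i_lt ?j_lt.
split; rewrite -sumN.
- apply: leq_trans (lesum (fun i => \sum_(j < N) p i j) _ iN).
  apply: (le1 i.+1 (fun i => \sum_(j < N) p i j)) => t ti; apply: leq_trans (leT (p t) _ jN).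
  exact: leq_trans p0 (homcol _ _ _ _).
- apply: leq_trans (leT (fun i => \sum_(j < N) p i j) _ iN).
  apply: leq_trans (lesum (p i) _ jN); apply: (le1 j.+1 (p i)) => t tj.
  exact: leq_trans p0 (homrow _ _ _ _).
Qed.

Lemma finite_rowed_plane_overpartition k n :
  finite_set [set a | rowed_plane_overpartition k n a].
Proof.
pose F (f : {ffun 'I_n * 'I_n -> 'I_n.+1 * bool}) : overarray := fun i j =>
  if insub i is Some i' then
    if insub j is Some j' then (val (f (i', j')).1, (f (i', j')).2)
    else (0, false) else (0, false).
apply: (@sub_finite_set _ _ (F @` setT)); last first.
  by apply: finite_image; exact: finite_finset.
move=> a /= [[pa za _ _] _]; have [len supp] := plane_partition_box pa.
exists [ffun x : 'I_n * 'I_n => (inord (a x.1 x.2).1, (a x.1 x.2).2)] => //.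
apply/funext => i; apply/funext => j; rewrite /F.
have out : n <= i \/ n <= j -> (0, false) = a i j.
  by move=> /supp h; have := za _ _ h; case: (a i j) h => x b /= -> ->.
case: insubP => [i' _ ii'|]; last by rewrite -leqNgt => h; apply: out; left.
case: insubP => [j' _ jj'|]; last by rewrite -leqNgt => h; apply: out; right.
rewrite !ffunE /= ii' jj' inordK; first by case: (a i j).
by rewrite ltnS len.
Qed.

Lemma finite_overpartition n : finite_set [set s | overpartition n s].
Proof.
pose F (f : 'I_n.+1 * {ffun 'I_n -> 'I_n.+1 * bool}) : seq (nat * bool) :=
  take f.1 [seq (val (f.2 i).1, (f.2 i).2) | i <- enum 'I_n].
apply: (@sub_finite_set _ _ (F @` setT)); last first.
  by apply: finite_image; exact: finite_finset.
move=> s /= [_ pos sums _].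
have sizes : size s <= n.
  rewrite -sums -(size_map fst) -/(unzip1 s); elim: (unzip1 s) pos => //= x t IH.
  by case/andP=> x0 /IH; rewrite -add1n; apply: leq_add.
have len i : (nth (0, false) s i).1 <= n.
  rewrite -sums; elim: {pos sums sizes} s i => [|x s IH] [|i] //=.
    exact: leq_addr.
  exact: leq_trans (IH i) (leq_addl _ _).
exists (inord (size s), [ffun i : 'I_n =>
  (inord (nth (0, false) s i).1, (nth (0, false) s i).2)]) => //.
rewrite /F inordK ?ltnS //; set e := map _ _.
have size_e : size e = n by rewrite size_map size_enum_ord.
have size_t : size (take (size s) e) = size s by rewrite size_takel // size_e.
apply: (@eq_from_nth _ (0, false)) => [//|i]; rewrite size_t => ilt.
have iltn : i < n by exact: leq_trans ilt sizes.
rewrite nth_take // (nth_map (Ordinal iltn)) ?size_enum_ord // ffunE /=.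
by rewrite nth_enum_ord // inordK ?ltnS //; case: (nth _ _ _).
Qed.

(* Main.v *)
Require Import Defs.
From mathcomp Require Import all_boot finmap zify.
From mathcomp Require Import boolp classical_sets functions cardinality.

Set Implicit Arguments.
Unset Strict Implicit.
Unset Printing Implicit Defensive.

(* No generating function is needed. In a plane overpartition every value that
   occurs has a cell whose overlining is free (the last occurrence in the first
   row containing the value). If two values occur, toggling two such cells shows
   that these arrays are counted by a multiple of 4. If only one value v occurs,
   the overlining rules exclude a 2 x 2 square, so the shape is a hook of size
   h = n / v, with exactly one free cell. Hence for n >= 1
     pl_K(n) = 2 sum_(h | n) min(h, K)   and   p(n) = 2 d(n)   (mod 4),
   and for K = 2k+1 the two differ by twice the number of even divisors of n
   that are at most 2k. These are all k even numbers up to 2k when n is a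
   positive multiple of l, and 2, 4, ..., 2^j when n is 2^j modulo l. *)

(** * Counting modulo 4 with toggles *)

Lemma card_fset_filterC (T : choiceType) (A : {fset T}) (b : pred T) :
  #|` A| = #|` [fset x in A | b x]%fset| + #|` [fset x in A | ~~ b x]%fset|.
Proof.
rewrite -(cardfsID [fset x in A | b x]%fset A).
congr addn; apply: (congr1 (fun B : {fset T} => #|` B|)).
  by apply/fsetP => x; rewrite !inE /=; case: (x \in A).
by apply/fsetP => x; rewrite !inE /=; case: (x \in A); rewrite ?andbF ?andbT.
Qed.

(** The map [f] exchanges the members of [A] that satisfy [b] with those that do not. *)
Lemma card_fset_toggle (T : choiceType) (A : {fset T}) (f : T -> T) (b : pred T) :
    {in A, forall x, f x \in A} -> {in A, involutive f} ->
    {in A, forall x, b (f x) = ~~ b x} ->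
  #|` A| = 2 * #|` [fset x in A | b x]%fset|.
Proof.
move=> fA fK bf; rewrite (card_fset_filterC A b) mul2n -addnn; congr addn.
have -> : [fset x in A | ~~ b x]%fset = [fset f x | x in [fset x in A | b x]]%fset.
  apply/fsetP => x; apply/idP/imfsetP; rewrite !inE /=.
    case/andP=> xA nbx; exists (f x); last by rewrite fK.
    by rewrite !inE /= fA // bf.
  by case=> y; rewrite !inE /= => /andP[yA yb] ->; rewrite fA // bf // yb.
rewrite card_in_imfset //= => x y; rewrite !inE /= => /andP[xA _] /andP[yA _] e.
by rewrite -(fK x) // e fK.
Qed.

Lemma card_fset_size (T : choiceType) (A : {fset T}) (s : seq T) : uniq s -> A =i s -> #|` A| = size s.
Proof. by move=> us As; apply/perm_size/uniq_perm. Qed.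

(** The toggle [f] halves [A] according to [b]. Since [g] preserves [b], it acts on the half where
    [b] holds and halves it again according to [c]. *)
Lemma dvdn4_card_fset_toggles (T : choiceType) (A : {fset T})
    (f g : T -> T) (b c : pred T) :
    {in A, forall x, f x \in A} -> {in A, forall x, g x \in A} ->
    {in A, involutive f} -> {in A, involutive g} ->
    {in A, forall x, b (f x) = ~~ b x} -> {in A, forall x, c (g x) = ~~ c x} ->
    {in A, forall x, b (g x) = b x} ->
  4 %| #|` A|.
Proof.
move=> fA gA fK gK bf cg bg; rewrite (card_fset_toggle fA fK bf).
rewrite (@card_fset_toggle _ _ g c); last 3 first.
- by move=> x; rewrite !inE /= => /andP[xA bx]; rewrite gA // bg.
- by move=> x; rewrite !inE /= => /andP[xA _]; exact: gK.
- by move=> x; rewrite !inE /= => /andP[xA _]; exact: cg.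
by rewrite mulnA dvdn_mulr.
Qed.

(** * Overpartitions modulo 4 *)

Definition flip i (s : seq (nat * bool)) : seq (nat * bool) :=
  let x := nth (0, false) s i in set_nth (0, false) s i (x.1, ~~ x.2).

Lemma size_flip i s : i < size s -> size (flip i s) = size s.
Proof. by move=> h; rewrite size_set_nth; apply/maxn_idPr. Qed.

Lemma nth_flip i s j : nth (0, false) (flip i s) j =
  let x := nth (0, false) s j in (x.1, x.2 (+) (j == i)).
Proof.
rewrite nth_set_nth /=; case: eqP => [->|_]; first by rewrite addbT.
by rewrite addbF; case: nth.
Qed.

Lemma unzip1_flip i s : i < size s -> unzip1 (flip i s) = unzip1 s.
Proof.
move=> h; apply: (@eq_from_nth _ 0); rewrite !size_map size_flip // => j js.
by rewrite !(nth_map (0, false)) ?size_flip // nth_flip.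
Qed.

Lemma flipK i s : i < size s -> flip i (flip i s) = s.
Proof.
move=> h; apply: (@eq_from_nth _ (0, false)); rewrite !size_flip // => j js.
by rewrite !nth_flip /= addbK; case: nth.
Qed.

(** Only an equal earlier part constrains the bit of a part, and the part at [i] has none. *)
Lemma overpartition_flip n s i : i < size s ->
    (forall i', i' < i -> nth 0 (unzip1 s) i' <> nth 0 (unzip1 s) i) ->
  overpartition n s -> overpartition n (flip i s).
Proof.
move=> ilt first_i [h1 h2 h3 h4]; split; rewrite ?unzip1_flip // => m m'.
rewrite size_flip // => /andP[m'm ms] e.
have := h4 m m'; rewrite m'm ms => /(_ isT e).
rewrite !(nth_map (0, false)) ?size_flip // nth_flip /= => ->.
by case: eqP => // mi; case: (first_i m'); rewrite -mi.
Qed.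

(* The first part different from the largest one; [size s] if there is none. *)
Definition second_index (s : seq (nat * bool)) :=
  find (predC1 (head 0 (unzip1 s))) (unzip1 s).

Definition two_parts (s : seq (nat * bool)) := second_index s < size s.

Lemma second_index_flip s i : i < size s ->
  second_index (flip i s) = second_index s.
Proof. by move=> h; rewrite /second_index unzip1_flip. Qed.

Lemma second_index_first s i : two_parts s -> i < second_index s ->
  nth 0 (unzip1 s) i <> nth 0 (unzip1 s) (second_index s).
Proof.
rewrite /two_parts /second_index -(size_map fst s) -/(unzip1 s) -has_find.
by move=> /(nth_find 0) /= /eqP ne /(before_find 0) /= /eqP ->; exact/nesym.
Qed.

Lemma second_index_gt0 s : two_parts s -> 0 < second_index s.
Proof. by case: s => [|[v b] s] //; rewrite /second_index /= eqxx. Qed.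

(** Here [x] pairs the number of equal parts with the bit of the first one, the only bit that is
    free. *)
Definition flat_overpartition n (x : nat * bool) : seq (nat * bool) :=
  (n %/ x.1, x.2) :: nseq x.1.-1 (n %/ x.1, false).

Lemma unzip1_flat_overpartition n h b : 0 < h ->
  unzip1 (flat_overpartition n (h, b)) = nseq h (n %/ h).
Proof. by case: h => //= h _; rewrite /unzip1 map_nseq. Qed.

Lemma overpartition_flat n h b : 0 < n -> h %| n ->
  overpartition n (flat_overpartition n (h, b)).
Proof.
move=> n0 hn; have h0 := dvdn_gt0 n0 hn.
have v0 : 0 < n %/ h by rewrite divn_gt0 // dvdn_leq.
split; rewrite ?unzip1_flat_overpartition //.
- case: h {hn h0 v0} => //= h; move: (n %/ _) => v.
  by elim: h => //= h ->; rewrite leqnn.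
- by rewrite all_nseq v0 orbT.
- by rewrite sumn_nseq divnK.
- case=> [|i] i' //=; rewrite size_nseq ltnS => /andP[_ ih] _.
  by rewrite /unzip2 map_nseq nth_nseq if_same.
Qed.

Lemma overpartition_one_part n s : 0 < n -> overpartition n s ->
  ~~ two_parts s -> exists h b, h %| n /\ s = flat_overpartition n (h, b).
Proof.
move=> n0 [_ pos sums bits]; rewrite /two_parts /second_index.
rewrite -(size_map fst s) -/(unzip1 s) -has_find -all_predC.
case: s pos sums bits => [|[v b] s] /=; first by move=> _ e; rewrite -e in n0.
move=> /andP[v0 _] sums bits /andP[_ alls].
have {}alls : unzip1 s = nseq (size s) v.
  rewrite -[size s](size_map fst); apply/all_pred1P; apply: sub_all alls => x.
  by rewrite /= negbK.
have nE : (size s).+1 * v = n by rewrite -sums alls sumn_nseq mulSn mulnC.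
exists (size s).+1, b; split; first by rewrite -nE dvdn_mulr.
rewrite /flat_overpartition /= -{1}nE -[in RHS]nE mulKn //; congr (_ :: _).
apply: (@eq_from_nth _ (0, false)); rewrite ?size_nseq // => i ilt.
rewrite nth_nseq ilt; have := bits i.+1 0; rewrite /= ltnS ilt.
rewrite alls nth_nseq ilt => /(_ isT erefl); rewrite (nth_map (0, false)) //.
have := congr1 (fun t => nth 0 t i) alls; rewrite (nth_map (0, false)) //.
by rewrite nth_nseq ilt; case: nth => ? ? /= -> ->.
Qed.

Lemma p_bar_mod4 n : 0 < n -> p_bar n = 2 * size (divisors n) %[mod 4].
Proof.
move=> n0; rewrite /p_bar; set A := fset_set _.
have AE s : (s \in A) = `[<overpartition n s>].
  by rewrite in_fset_set; [rewrite /in_mem /= | exact: finite_overpartition].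
rewrite (card_fset_filterC A two_parts) -modnDml.
(* The two toggles act on the first occurrences of the largest part and of the next distinct one.
   Neither changes the parts, so both positions stay fixed; the second position is positive, so the
   second toggle leaves bit 0 alone. *)
have /eqP-> : 4 %| #|` [fset x in A | two_parts x]%fset|.
  apply: (@dvdn4_card_fset_toggles _ _ (flip 0) (fun s => flip (second_index s) s)
    (fun s => (nth (0, false) s 0).2)
    (fun s => (nth (0, false) s (second_index s)).2)).
  - move=> s; rewrite !inE /= AE => /andP[/asboolP os ts].
    have s0 : 0 < size s by exact: leq_trans ts.
    rewrite AE /two_parts second_index_flip // size_flip // -/(two_parts s).
    by rewrite ts andbT; apply/asboolP/overpartition_flip.
  - move=> s; rewrite !inE /= AE => /andP[/asboolP os ts].
    rewrite AE /two_parts second_index_flip // size_flip // -/(two_parts s) ts andbT.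
    by apply/asboolP/overpartition_flip => // i; exact: second_index_first.
  - move=> s; rewrite !inE /= AE => /andP[_ ts].
    by rewrite flipK //; exact: leq_trans ts.
  - move=> s; rewrite !inE /= AE => /andP[_ ts].
    by rewrite second_index_flip // flipK.
  - by move=> s _; rewrite nth_flip /= addbT.
  - move=> s; rewrite !inE /= AE => /andP[_ ts].
    by rewrite second_index_flip // nth_flip /= eqxx addbT.
  - move=> s; rewrite !inE /= AE => /andP[_ ts].
    by rewrite nth_flip /= eq_sym (gtn_eqF (second_index_gt0 ts)) addbF.
(* The overpartitions left have all parts equal: each is given by a divisor of [n] and one bit. *)
rewrite add0n; pose L := [seq (h, b) | h <- divisors n, b <- [:: true; false]].
have LE h b : reflect (h %| n) ((h, b) \in L).
  apply: (iffP allpairsP) => [[[? ?] /= [hL _ [-> _]]]|hn].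
    by rewrite dvdn_divisors.
  by exists (h, b) => /=; rewrite -dvdn_divisors //; split=> //; case: b.
rewrite (@card_fset_size _ _ [seq flat_overpartition n x | x <- L]).
- by rewrite size_map size_allpairs mulnC.
- rewrite map_inj_in_uniq.
    by apply: allpairs_uniq => // [|[? ?] [? ?] _ _ []]; [exact: divisors_uniq | move=> /= -> ->].
  move=> [h b] [h' b'] /LE hn /LE hn' e; have := congr1 size e; rewrite /= !size_nseq.
  move: (dvdn_gt0 n0 hn) (dvdn_gt0 n0 hn') => h0 h0'; rewrite !prednK // => ->.
  by case: e => _ ->.
- move=> s; rewrite !inE /= AE; apply/andP/mapP.
    case=> /asboolP /overpartition_one_part os /os[//|h [b [hn ->]]].
    by exists (h, b) => //; apply/LE.
  case=> [[h b]] /LE hn ->; have h0 := dvdn_gt0 n0 hn.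
  split; first by apply/asboolP; exact: overpartition_flat.
  rewrite /two_parts /second_index -(size_map fst) -/(unzip1 _) -has_find.
  rewrite unzip1_flat_overpartition // has_nseq; case: h h0 {hn} => //= h _.
  by rewrite eqxx.
Qed.

(** * Free cells of plane overpartitions *)

Definition values (a : overarray) : nat -> nat -> nat := fun i j => (a i j).1.

Lemma plane_partition_anti n p i i' j j' : plane_partition n p ->
  i <= i' -> j <= j' -> p i' j' <= p i j.
Proof.
case=> prow pcol _ ii' jj'; apply: (@leq_trans (p i j')).
  rewrite -(subnKC ii'); elim: (i' - i) => [|d]; rewrite ?addn0 ?addnS //.
  exact: leq_trans (pcol _ _).
rewrite -(subnKC jj'); elim: (j' - j) => [|d]; rewrite ?addn0 ?addnS //.
exact: leq_trans (prow _ _).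
Qed.

Lemma plane_partition_head_gt0 n p : 0 < n -> plane_partition n p -> 0 < p 0 0.
Proof.
move=> n0 pp; have [_ _ [m [_ sum_m]]] := pp.
rewrite lt0n; apply/eqP => p00; move: n0; rewrite -sum_m big1 // => i _.
rewrite big1 // => j _; apply/eqP; rewrite -leqn0 -p00.
exact: plane_partition_anti pp _ _.
Qed.

(* The cells whose overlining is free: the last occurrence of a value in its
   row which is also the first occurrence of that value in its column. *)
Definition corner (p : nat -> nat -> nat) (c : nat * nat) : Prop :=
  (forall j, c.2 < j -> p c.1 j <> p c.1 c.2) /\
  (forall i, i < c.1 -> p i c.2 <> p c.1 c.2).

Lemma exists_corner n p i0 j0 : plane_partition n p -> 0 < p i0 j0 ->
  exists c, corner p c /\ p c.1 c.2 = p i0 j0.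
Proof.
move=> [_ _ [m [pm _]]] p0.
have exi : exists i, `[<exists j, p i j = p i0 j0>].
  by exists i0; apply/asboolP; exists j0.
case: (ex_minnP exi) => i /asboolP[j1 pij1] mini.
have exj : exists j, p i j == p i0 j0 by exists j1; rewrite pij1.
(* The array vanishes from column [m] on, so a positive value has a last occurrence in its row. *)
have ubj j : p i j == p i0 j0 -> j <= m.
  by move=> /eqP pij; rewrite leqNgt; apply/negP => mj; move: p0;
    rewrite -pij pm //; right; exact: ltnW.
case: (ex_maxnP exj ubj) => j /eqP pij maxj.
exists (i, j); split=> //; split=> /= [j'|i'] lt; rewrite pij => e.
  by have := maxj j'; rewrite e eqxx leqNgt lt => /(_ isT).
have : i <= i' by apply: mini; apply/asboolP; exists j.
by rewrite leqNgt lt.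
Qed.

Definition toggle (c : nat * nat) (a : overarray) : overarray :=
  fun i j => ((a i j).1, (a i j).2 (+) ((i, j) == c)).

Lemma values_toggle c a : values (toggle c a) = values a.
Proof. by []. Qed.

Lemma toggleK c : involutive (toggle c).
Proof.
move=> a; apply/funext => i; apply/funext => j.
by rewrite /toggle /= addbK; case: (a i j).
Qed.

(** The row rule constrains a cell with an equal entry to its right, the column rule one with an
    equal entry above it. A corner has neither. *)
Lemma rowed_plane_overpartition_toggle K n a c :
    corner (values a) c -> 0 < values a c.1 c.2 ->
  rowed_plane_overpartition K n a -> rowed_plane_overpartition K n (toggle c a).
Proof.
move=> [lastr firstc] c0 [[pp z rows cols] rowsK]; split=> //; split=> //.
- move=> i j /= e; rewrite (z _ _ e) /=; case: eqP => // ec.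
  by move: c0; rewrite -ec /values /= e.
- move=> i j j' /= p0 jj' e; rewrite (rows i j j') //=; case: eqP => // ec.
  by case: (lastr j'); rewrite -ec.
- move=> i i' j /= p0 ii' e; rewrite (cols i i' j) //=; case: eqP => // ec.
  by case: (firstc i'); rewrite -ec.
Qed.

Definition two_values (p : nat -> nat -> nat) : Prop :=
  exists i j, 0 < p i j /\ p i j <> p 0 0.

(** The choice depends on the values only, so toggling the chosen cell does not change the choice
    and is an involution. The default [(0, 0)] is never reached for a plane partition of positive
    size. *)
Definition head_corner (p : nat -> nat -> nat) : nat * nat :=
  xget (0, 0) [set c | corner p c /\ p c.1 c.2 = p 0 0]%classic.

Definition other_corner (p : nat -> nat -> nat) : nat * nat :=
  xget (0, 0) [set c | [/\ corner p c, 0 < p c.1 c.2 & p c.1 c.2 <> p 0 0]]%classic.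

Lemma head_cornerP n p : 0 < n -> plane_partition n p ->
  corner p (head_corner p) /\ p (head_corner p).1 (head_corner p).2 = p 0 0.
Proof.
move=> n0 pp; apply: (@xgetPex _ _ [set c | corner p c /\ p c.1 c.2 = p 0 0]%classic).
exact: exists_corner pp (plane_partition_head_gt0 n0 pp).
Qed.

Lemma other_cornerP n p : plane_partition n p -> two_values p ->
  let c := other_corner p in [/\ corner p c, 0 < p c.1 c.2 & p c.1 c.2 <> p 0 0].
Proof.
move=> pp [i [j [pij0 pij]]] c; apply: (@xgetPex _ (0, 0)
  [set c | [/\ corner p c, 0 < p c.1 c.2 & p c.1 c.2 <> p 0 0]]%classic).
have [d [dc pd]] := exists_corner pp pij0.
by exists d; rewrite /= pd.
Qed.

(** * Hooks *)

(** The hook has [h] cells, [r] of them below the first row; [j + r < h] says that column [j] is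
    among the first [h - r] without truncated subtraction. *)
Definition hook_value v h r i j : nat :=
  if i == 0 then v * (j + r < h) else v * ((j == 0) && (i <= r)).

(* The constant plane partition whose shape is the hook with [h] cells, [r.+1]
   of them in the first column; the end of its first row is a corner, and [b]
   tells whether it is overlined. *)
Definition hook n (x : nat * nat * bool) : overarray := fun i j =>
  (hook_value (n %/ x.1.1) x.1.1 x.1.2 i j,
   if i == 0 then ((j + x.1.2).+1 == x.1.1) && x.2
   else (j == 0) && (i <= x.1.2)).

Lemma sum_ord_ltn m s : \sum_(j < m) (j < s) = minn m s.
Proof.
elim: m => [|m IH]; first by rewrite big_ord0 min0n.
by rewrite big_ord_recr /= IH; lia.
Qed.

(** The first row contributes [v * (h - r)] and the cells below it [v * r]; the bounds on [m] make
    the square contain the hook. *)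
Lemma sum_hook_value v h r m : r < h -> h - r <= m -> r < m ->
  \sum_(i < m) \sum_(j < m) hook_value v h r i j = v * h.
Proof.
case: m => // m rh hm rm; rewrite big_ord_recl.
rewrite (eq_bigr (fun j : 'I_m.+1 => v * (j < h - r))); last first.
  by move=> j _; rewrite /hook_value /= ltn_subRL addnC.
rewrite -big_distrr sum_ord_ltn /=.
rewrite (eq_bigr (fun i : 'I_m => v * (i < r))) => [|i _].
  rewrite -big_distrr sum_ord_ltn /= -mulnDr; congr (_ * _); lia.
rewrite big_ord_recl /= big1 ?addn0 => [|j _].
  by rewrite /hook_value.
by rewrite /hook_value /= muln0.
Qed.

Lemma plane_partition_hook_value n h r : 0 < n -> h %| n -> r < h ->
  plane_partition n (hook_value (n %/ h) h r).
Proof.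
move=> n0 hn rh; rewrite /hook_value; split.
- by move=> [|i] j /=; rewrite leq_mul2l; apply/orP; right; lia.
- by move=> [|i] j /=; rewrite leq_mul2l; apply/orP; right; lia.
- exists h; split; last by rewrite sum_hook_value ?divnK //; lia.
  move=> [|i] j /= ij; apply/eqP; rewrite muln_eq0; apply/orP; right; lia.
Qed.

Lemma rowed_plane_overpartition_hook K n h r b :
    0 < n -> h %| n -> r < minn h K ->
  rowed_plane_overpartition K n (hook n (h, r, b)).
Proof.
move=> n0 hn; rewrite leq_min => /andP[rh rK].
have h0 := dvdn_gt0 n0 hn.
have v0 : 0 < n %/ h by rewrite divn_gt0 // dvdn_leq.
have pp := plane_partition_hook_value n0 hn rh.
split; last first.
  move=> [|i] j Ki /=; first lia.
  rewrite /hook_value /=; have /negbTE-> : ~~ (i < r) by lia.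
  by rewrite andbF muln0.
split=> //; rewrite /hook /hook_value /=.
- move=> [|i] j /= /eqP; rewrite muln_eq0 (gtn_eqF v0) /=; lia.
- move=> [|i] j j' /=; rewrite muln_gt0 v0 /= => p0 jj' /eqP;
    rewrite eqn_mul2l (gtn_eqF v0) /=; lia.
- move=> [|i] [|i'] j /=; rewrite muln_gt0 v0 /= => p0 ii' /eqP;
    rewrite eqn_mul2l (gtn_eqF v0) /=; lia.
Qed.

Lemma not_two_values_hook v h r : r < h -> ~ two_values (hook_value v h r).
Proof.
move=> rh [i [j []]]; rewrite /hook_value /= add0n rh muln1.
by case: ifP => _; case: (X in v * nat_of_bool X); rewrite ?muln0 ?muln1.
Qed.

(** The entry at the origin gives [n %/ h], hence [h]; the length of the first column gives [r]; the
    bit at the end of the first row gives [b]. *)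
Lemma hook_inj n : 0 < n -> {in [pred x | (x.1.1 %| n) && (x.1.2 < x.1.1)] &,
  injective (hook n)}.
Proof.
move=> n0 [[h r] b] [[h' r'] b'] /andP[/= hn rh] /andP[/= hn' rh'] e.
have h0 := dvdn_gt0 n0 hn.
have v0 : 0 < n %/ h by rewrite divn_gt0 // dvdn_leq.
have eij i j : hook n (h, r, b) i j = hook n (h', r', b') i j by rewrite e.
have ev : n %/ h = n %/ h'.
  by have /(congr1 fst) := eij 0 0; rewrite /= /hook_value /= !add0n rh rh' !muln1.
have eh : h = h'.
  by apply/eqP; rewrite -(eqn_pmul2l v0) {2}ev !divnK.
subst h'; have er i : (i <= r) = (i <= r').
  have /(congr1 fst)/eqP := eij i 0; rewrite /= /hook_value /=.
  case: i => [|i] //=; rewrite eqn_mul2l (gtn_eqF v0) /=.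
  by case: (i < r); case: (i < r').
have {}er : r = r'.
  by apply/eqP; rewrite eqn_leq er -er !leqnn.
(* Column [h.-1 - r] is the end of the first row. *)
subst r'; have /(congr1 snd) := eij 0 (h.-1 - r).
have e1 : (h.-1 - r + r).+1 == h by lia.
by rewrite /= e1 /= => ->.
Qed.

Lemma one_value_hook K n a : 0 < n -> rowed_plane_overpartition K n a ->
    ~ two_values (values a) ->
  exists h r b, [/\ h %| n, r < minn h K & a = hook n (h, r, b)].
Proof.
move=> n0 [[pp z rows cols] rowsK] ntv.
have v0 := plane_partition_head_gt0 n0 pp.
have anti i i' j j' := @plane_partition_anti _ _ i i' j j' pp.
set v := (a 0 0).1 in v0.
have p0v i j : (a i j).1 <> 0 -> (a i j).1 = v.
  move=> /eqP; rewrite -lt0n => pij; apply: contrapT => ne; apply: ntv.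
  by exists i, j.
have [_ _ [m [pm sum_m]]] := pp.
(* The lengths of the first row and of the first column are [s] and [t]. *)
have exs : exists s, (a 0 s).1 == 0 by exists m; rewrite pm //; right.
case: (ex_minnP exs) => s /eqP ps mins.
have ext : exists t, (a t 0).1 == 0 by exists m; rewrite pm //; left.
case: (ex_minnP ext) => t /eqP pt mint.
have s0 : 0 < s by case: s ps {mins} => // p00; rewrite /v p00 in v0.
have t0 : 0 < t by case: t pt {mint} => // p00; rewrite /v p00 in v0.
have tK : t <= K by apply: mint; rewrite rowsK.
have sm : s <= m by apply: mins; rewrite pm //; right.
have tm : t <= m by apply: mint; rewrite pm //; left.
have row0 j : (a 0 j).1 = v * (j < s).
  case: (ltnP j s) => js; rewrite ?muln1 ?muln0.
    by apply: p0v => /eqP /mins; rewrite leqNgt js.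
  by apply/eqP; rewrite -leqn0 -ps anti.
have col0 i : (a i 0).1 = v * (i < t).
  case: (ltnP i t) => it; rewrite ?muln1 ?muln0.
    by apply: p0v => /eqP /mint; rewrite leqNgt it.
  by apply/eqP; rewrite -leqn0 -pt anti.
(* Were this entry positive, the cell (1, 0) would also have value [v]: the row rule, with (1, 1),
   would forbid its overlining, and the column rule, with (0, 0), would force it. *)
have p11 : (a 1 1).1 = 0.
  apply: contrapT => ne; have e := p0v _ _ ne.
  have e10 : (a 1 0).1 = v.
    by apply: p0v => e10; have := anti 1 1 0 1 isT isT; rewrite e10 e; lia.
  have f10 : (a 1 0).2 = false by apply: (rows 1 0 1); rewrite ?e10 ?e.
  have t10 : (a 1 0).2 = true by apply: (cols 1 0 0); rewrite ?e10.
  by rewrite f10 in t10.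
have inner i j : (a i.+1 j.+1).1 = 0.
  by apply/eqP; rewrite -leqn0 -p11 (anti 1 i.+1 1 j.+1).
(* The row and the column share the origin, so there are [s + t - 1] cells. *)
pose r := t.-1; pose h := s + r.
have rh : r < h by lia.
have valE i j : (a i j).1 = hook_value v h r i j.
  rewrite /hook_value; case: i => [|i] /=; first by rewrite row0 ltn_add2r.
  case: j => [|j]; last by rewrite inner muln0.
  by rewrite col0 /r; congr (_ * _); lia.
have nE : v * h = n.
  rewrite -sum_m -(@sum_hook_value v h r m) //; try lia.
  by apply: eq_bigr => i _; apply: eq_bigr => j _; rewrite valE.
have h0 : 0 < h by lia.
(* The free bit is the one at the end of the first row, in column [s.-1]. *)
exists h, r, (a 0 s.-1).2; split; first by rewrite -nE dvdn_mull.
  by rewrite leq_min rh /r; lia.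
apply/funext => i; apply/funext => j; rewrite /hook /= -nE mulnK // -valE.
rewrite [LHS]surjective_pairing; congr pair.
have [e|ne] := eqVneq (a i j).1 0.
  rewrite z //; move/eqP: e; rewrite valE /hook_value.
  by case: i => [|i] /=; rewrite muln_eq0 (gtn_eqF v0) /=; lia.
have pv : (a i j).1 = v by apply: p0v; apply/eqP.
(* In the first row, a cell before the end has an equal right neighbour and is not overlined. Below
   it, a cell of the first column repeats the value at the origin and is overlined. *)
case: i ne pv => [|i] ne pv /=.
  move: ne; rewrite row0 muln_eq0 negb_or => /andP[_]; rewrite eqb0 negbK => js.
  have [js1|js1] := eqVneq j s.-1; first by rewrite js1 /h; have -> : (s.-1 + r).+1 == s + r by lia.
  have -> : (j + r).+1 == h = false by lia.
  have js2 : j.+1 < s by lia.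
  by apply: (rows 0 j j.+1); rewrite ?pv // row0 js2 muln1.
case: j ne pv => [|j]; last by rewrite inner.
rewrite col0 muln_eq0 negb_or => /andP[_]; rewrite eqb0 negbK => it pv.
have -> : i < r by lia.
by apply: (cols i.+1 0 0); rewrite ?(col0 i.+1) ?it ?muln1.
Qed.

(** * Plane overpartitions modulo 4 *)

Lemma pl_bar_mod4 K n : 0 < n ->
  pl_bar K n = 2 * \sum_(h <- divisors n) minn h K %[mod 4].
Proof.
move=> n0; rewrite /pl_bar; set A := fset_set _.
have AE a : (a \in A) = `[<rowed_plane_overpartition K n a>].
  by rewrite in_fset_set; [rewrite /in_mem /= | exact: finite_rowed_plane_overpartition].
pose Q (a : overarray) := `[<two_values (values a)>].
rewrite (card_fset_filterC A Q) -modnDml.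
(* The two chosen corners carry different values, hence are different cells, so the second toggle
   preserves the bit at the first corner. *)
have /eqP-> : 4 %| #|` [fset x in A | Q x]%fset|.
  apply: (@dvdn4_card_fset_toggles _ _
    (fun a => toggle (head_corner (values a)) a)
    (fun a => toggle (other_corner (values a)) a)
    (fun a => (a (head_corner (values a)).1 (head_corner (values a)).2).2)
    (fun a => (a (other_corner (values a)).1 (other_corner (values a)).2).2)).
  - move=> a; rewrite !inE /= AE => /andP[/asboolP pa qa].
    rewrite AE /Q values_toggle -/(Q a) qa andbT; apply/asboolP.
    have pp : plane_partition n (values a) by case: pa => [[]].
    have [hc ha] := head_cornerP n0 pp.
    apply: rowed_plane_overpartition_toggle => //; rewrite ha.
    exact: plane_partition_head_gt0 pp.
  - move=> a; rewrite !inE /= AE => /andP[/asboolP pa qa].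
    rewrite AE /Q values_toggle -/(Q a) qa andbT; apply/asboolP.
    have pp : plane_partition n (values a) by case: pa => [[]].
    have [oc oa _] := other_cornerP pp (asboolW qa).
    exact: rowed_plane_overpartition_toggle.
  - by move=> a _; rewrite values_toggle toggleK.
  - by move=> a _; rewrite values_toggle toggleK.
  - by move=> a _; rewrite values_toggle /toggle /= -surjective_pairing eqxx addbT.
  - by move=> a _; rewrite values_toggle /toggle /= -surjective_pairing eqxx addbT.
  - move=> a; rewrite !inE /= AE => /andP[/asboolP pa qa].
    have pp : plane_partition n (values a) by case: pa => [[]].
    have [_ _ oa] := other_cornerP pp (asboolW qa).
    have [_ ha] := head_cornerP n0 pp.
    rewrite values_toggle /toggle /= -surjective_pairing; case: eqP => [e|].
      by case: oa; rewrite -e ha.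
    by rewrite addbF.
(* What remains are hooks: a divisor [h] of [n], a number [r] of cells below the first row, and a
   bit. Having at most [K] rows means [r < K]. *)
rewrite add0n; pose L2 := [seq (h, r) | h <- divisors n, r <- iota 0 (minn h K)].
pose L := [seq (x, b) | x <- L2, b <- [:: true; false]].
have L2E h r : reflect (h %| n /\ r < minn h K) ((h, r) \in L2).
  apply: (iffP allpairsPdep) => [[h' [r' [+ + [-> ->]]]]|[hn rh]].
    by rewrite -dvdn_divisors // mem_iota.
  by exists h, r; rewrite -dvdn_divisors // mem_iota.
have LE h r b : reflect (h %| n /\ r < minn h K) ((h, r, b) \in L).
  apply: (iffP allpairsP) => [[[[? ?] ?] /= [xL _ [-> -> _]]]|hr].
    exact/L2E.
  by exists (h, r, b) => /=; split=> //; [exact/L2E | case: b].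
rewrite (@card_fset_size _ _ [seq hook n x | x <- L]).
- rewrite size_map size_allpairs mulnC size_allpairs_dep sumnE big_map.
  by under eq_bigr do rewrite size_iota.
- rewrite map_inj_in_uniq.
    apply: allpairs_uniq => // [|[? ?] [? ?] _ _ []]; last by move=> /= -> ->.
    apply: allpairs_uniq_dep => [|h _|[? ?] [? ?] _ _ []]; last by move=> /= -> ->.
      exact: divisors_uniq.
    exact: iota_uniq.
  move=> [[h r] b] [[h' r'] b'] /LE[hn] + /LE[hn']; rewrite !leq_min.
  by move=> /andP[rh _] /andP[rh' _]; apply: hook_inj; rewrite // inE /= ?hn ?hn'.
- move=> a; rewrite !inE /= AE; apply/andP/mapP.
    case=> /asboolP pa /asboolPn qa.
    have [h [r [b [hn rh ->]]]] := one_value_hook n0 pa qa.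
    by exists (h, r, b) => //; apply/LE.
  case=> [[[h r] b]] /LE[hn rh] ->; split.
    by apply/asboolP; exact: rowed_plane_overpartition_hook.
  apply/asboolPn; apply: not_two_values_hook.
  by move: rh; rewrite leq_min => /andP[].
Qed.

(** * Size 0, where there is no part to toggle *)

Lemma pl_bar0 K : pl_bar K 0 = 1.
Proof.
rewrite /pl_bar.
suff -> : [set a | rowed_plane_overpartition K 0 a]%classic =
  [set (fun _ _ => (0, false))]%classic by rewrite fset_set1 cardfs1.
apply/seteqP; split=> a /=.
  case=> [[pp z _ _] _]; have [le0 _] := plane_partition_box pp.
  apply/funext => i; apply/funext => j.
  have e : (a i j).1 = 0 by apply/eqP; rewrite -leqn0 le0.
  by have := z _ _ e; case: (a i j) e => ? ? /= -> ->.
move=> ->; split=> //; split=> //; split=> //.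
by exists 0; split=> //; rewrite big_ord0.
Qed.

Lemma p_bar0 : p_bar 0 = 1.
Proof.
rewrite /p_bar.
suff -> : [set s | overpartition 0 s]%classic = [set [::]]%classic.
  by rewrite fset_set1 cardfs1.
apply/seteqP; split=> s /=; last first.
  by move=> ->; split=> // i i'; rewrite ltn0 andbF.
case; case: s => //= x s _ /andP[x0 _] e _; lia.
Qed.

(** * Parity of the number of small even divisors *)

Definition small_even k h := ~~ odd h && (h <= 2 * k).

(** Since [2 * k + 1] is odd, [minn h (2 * k + 1)] is even exactly when [h] is even and at most
    [2 * k]. All other divisors contribute an odd term, as they do to the number of divisors. *)
Lemma pl_bar_p_bar_mod4 k n : 0 < n ->
    ~~ odd (count (small_even k) (divisors n)) ->
  pl_bar (2 * k + 1) n = p_bar n %[mod 4].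
Proof.
move=> n0 ev; rewrite pl_bar_mod4 // p_bar_mod4 //.
suff : odd (\sum_(h <- divisors n) minn h (2 * k + 1)) = odd (size (divisors n)).
  by lia.
have : {subset divisors n <= [pred h | 0 < h]}.
  by move=> h; rewrite -dvdn_divisors // => /(dvdn_gt0 n0).
(* Adding the even count makes the parities agree term by term, which allows induction on the
   list. *)
have -> : odd (size (divisors n)) =
    odd (size (divisors n) + count (small_even k) (divisors n)).
  by rewrite oddD (negbTE ev) addbF.
elim: (divisors n) => [|h s IH] sub; first by rewrite big_nil.
rewrite big_cons /= oddD IH => [|x xs]; last by rewrite sub // inE xs orbT.
have := sub h (mem_head _ _); rewrite inE /small_even.
by move: (size s) (count _ s) => x y; case: (leqP h (2 * k)); case: (boolP (odd h)); lia.
Qed.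

Lemma dvdn_lcm_evens k m : 0 < m -> small_even k m -> m %| lcm_evens k.
Proof.
move=> m0 /andP[mev mk]; rewrite /lcm_evens (big_rem m) /=.
  by rewrite dvdn2 mev dvdn_lcml.
by rewrite mem_index_iota m0 ltnS.
Qed.

Lemma count_small_even k n s : 0 < n -> uniq s ->
    (forall h, (h \in s) = [&& 0 < h, h %| n & small_even k h]) ->
  count (small_even k) (divisors n) = size s.
Proof.
move=> n0 us sE; rewrite -size_filter; apply/perm_size/uniq_perm => //.
  by rewrite filter_uniq ?divisors_uniq.
move=> h; rewrite mem_filter -dvdn_divisors // sE andbC.
by case: (boolP (h %| n)) => [/(dvdn_gt0 n0) ->|]; rewrite ?andbF.
Qed.

Lemma count_small_even_mul k n : 0 < lcm_evens k * n ->
  count (small_even k) (divisors (lcm_evens k * n)) = k.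
Proof.
move=> n0; rewrite (@count_small_even _ _ [seq 2 * i | i <- iota 1 k]) //.
- by rewrite size_map size_iota.
- by rewrite map_inj_uniq ?iota_uniq // => x y; lia.
move=> h; apply/mapP/and3P => [[i] | [h0 _ hk]].
  rewrite mem_iota => ik ->; have i0 : 0 < 2 * i by lia.
  have sm : small_even k (2 * i) by rewrite /small_even; lia.
  by rewrite i0 sm dvdn_mulr // dvdn_lcm_evens.
by exists h./2; rewrite ?mem_iota; move: hk; rewrite /small_even; lia.
Qed.

(** An even number up to [2 * k] divides [lcm_evens k], so it divides the sum exactly when it
    divides [2 ^ j]. The powers from 2 to [2 ^ j] all qualify because [2 ^ j <= 2 * k]. *)
Lemma count_small_even_exp k n j : 0 < j -> 2 ^ (j - 1) <= k ->
  count (small_even k) (divisors (lcm_evens k * n + 2 ^ j)) = j.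
Proof.
move=> j0 jk; have N0 : 0 < lcm_evens k * n + 2 ^ j.
  by rewrite addn_gt0 expn_gt0 orbT.
rewrite (@count_small_even _ _ [seq 2 ^ i | i <- iota 1 j]) //.
- by rewrite size_map size_iota.
- by rewrite map_inj_uniq ?iota_uniq //; exact: expnI.
have j2k : 2 ^ j <= 2 * k by rewrite -(subnKC j0) expnS leq_mul2l.
move=> h; apply/mapP/and3P => [[i] | [h0 hN hk]].
  rewrite mem_iota add1n ltnS => /andP[i0 ij] ->.
  have sm : small_even k (2 ^ i).
    rewrite /small_even oddX orbF -leqn0 leqNgt i0 /=.
    by rewrite (leq_trans _ j2k) // leq_exp2l.
  by rewrite expn_gt0 sm dvdn_add ?dvdn_exp2l // dvdn_mulr // dvdn_lcm_evens ?expn_gt0.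
move: hN; rewrite dvdn_addr; last by rewrite dvdn_mulr // dvdn_lcm_evens.
case/dvdn_pfactor => // i ij hE; exists i => //.
(* Exponent 0 is excluded because 1 is odd. *)
rewrite mem_iota add1n ltnS ij andbT; case: i hE {ij} => // h1.
by move: hk; rewrite h1.
Qed.

Theorem theorem1p7 (k : nat) (hk : 2 <= k) :
  (forall n j : nat, 1 <= n -> 2 <= j -> j = 0 %[mod 2] -> 2 ^ (j - 1) <= k ->
     pl_bar (2 * k + 1) (lcm_evens k * n + 2 ^ j)
       = p_bar (lcm_evens k * n + 2 ^ j) %[mod 4]) /\
  (k = 0 %[mod 2] -> forall n : nat,
     pl_bar (2 * k + 1) (lcm_evens k * n) = p_bar (lcm_evens k * n) %[mod 4]).
Proof.
split=> [n j _ j2 jev jk | kev n].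
  apply: pl_bar_p_bar_mod4; first by rewrite addn_gt0 expn_gt0 orbT.
  by rewrite count_small_even_exp //; lia.
(* Here [n] may be 0; both counts are then 1. *)
have [-> | N0] := posnP (lcm_evens k * n); first by rewrite pl_bar0 p_bar0.
by apply: pl_bar_p_bar_mod4 => //; rewrite count_small_even_mul //; lia.
Qed.
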